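(* Let $n\in\mathbb N$ and $k\in\mathbb Z$ with $n\ge k\ge 0$, and let $Z_k^n=\{(x_1,\dots,x_n)\in\mathbb R^n : |\{i : x_i\in\mathbb Z\}|\ge n-k\}$. If $d$ is the metric on $Z_k^n$ induced by the usual metric on $\mathbb R^n$, then $\operatorname{Ind}(u_dZ_k^n\setminus Z_k^n)=k$.
   Context: $\mathbb N=\{1,2,\dots\}$. Compactifications are Hausdorff. For a metric space $(X,d)$, let $U_d^*(X)$ be the set of all bounded uniformly continuous functions $X\to\mathbb R$. The Smirnov compactification $u_dX$ of $(X,d)$ is the compactification of $X$ associated with the closed subring $U_d^*(X)$ of $C^*(X)$ (the Banach algebra of bounded continuous real-valued functions with the sup-norm); concretely, it is the closure of $e(X)$ in $\prod_{f\in U_d^*(X)}[\inf f(X),\sup f(X)]$, where $e(x)=(f(x))_{f}$ is the evaluation map, and $X$ is identified with $e(X)$. The space $u_dX\setminus X$ is called the Smirnov remainder. Large inductive dimension $\operatorname{Ind}$ of a normal space $Y$: $\operatorname{Ind}Y=-1$ iff $Y=\emptyset$; for $n\ge 0$, $\operatorname{Ind}Y\le n$ iff for every pair $A,B$ of disjoint closed subsets of $Y$ there is a partition $L$ between $A$ and $B$ (a closed set $L\subset Y$ for which there are disjoint open sets $U\supset A$, $V\supset B$ with $Y\setminus L=U\cup V$) such that $\operatorname{Ind}L\le n-1$. $\operatorname{Ind}Y=n$ means $\operatorname{Ind}Y\le n$ and not $\operatorname{Ind}Y\le n-1$. *)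

(* Defs.v *)
From HB Require Import structures.
From mathcomp Require Import all_boot all_order all_algebra.
From mathcomp Require Import all_classical all_reals all_analysis.
From mathcomp Require Import ring.

Set Implicit Arguments.
Unset Strict Implicit.
Unset Printing Implicit Defensive.

Import Order.TTheory GRing.Theory Num.Theory.
Import numFieldNormedType.Exports.

Local Open Scope classical_set_scope.
Local Open Scope ring_scope.

(** The canonical uniform structure of ['rV[R]_n] comes from the sup norm;
    [euclid R n] is a copy of ['rV[R]_n] carrying the Euclidean metric. *)
Definition euclid (R : realType) (n : nat) : Type := 'rV[R]_n.

Section Euclid.
Variables (R : realType) (n : nat).
Implicit Types x y z : 'rV[R]_n.

HB.instance Definition _ := Choice.on (euclid R n).

Definition euclid_dist x y : R :=
  Num.sqrt (\sum_(i < n) (x ord0 i - y ord0 i) ^+ 2).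

Let sumsq_ge0 (a : 'I_n -> R) : 0 <= \sum_(i < n) a i ^+ 2.
Proof. by apply: sumr_ge0 => i _; exact: sqr_ge0. Qed.

Let cauchy_schwarz (a b : 'I_n -> R) :
  (\sum_(i < n) a i * b i) ^+ 2
    <= (\sum_(i < n) a i ^+ 2) * (\sum_(i < n) b i ^+ 2).
Proof.
set A := \sum_i a i ^+ 2; set B := \sum_i b i ^+ 2; set C := \sum_i a i * b i.
have quad (s t : R) : 0 <= s ^+ 2 * A - (s * t * C) *+ 2 + t ^+ 2 * B.
  suff -> : s ^+ 2 * A - (s * t * C) *+ 2 + t ^+ 2 * B
      = \sum_i (s * a i - t * b i) ^+ 2 by exact: sumsq_ge0.
  rewrite /A /B /C !mulr_sumr -sumrMnl -sumrB -big_split /=.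
  apply: eq_bigr => i _; rewrite sqrrB !exprMn; congr (_ - _ *+ 2 + _).
  by rewrite mulrACA.
have [B0|B0] := eqVneq B 0.
  have b0 i : b i = 0.
    apply/eqP; rewrite -sqrf_eq0; apply/eqP; move/eqP: B0.
    by rewrite psumr_eq0 => [/allP/(_ i)|j _]; rewrite ?sqr_ge0//;
      rewrite mem_index_enum => /(_ isT) /eqP.
  suff -> : C = 0 by rewrite expr0n/= B0 mulr0.
  by rewrite /C big1 // => i _; rewrite b0 mulr0.
have Bgt0 : 0 < B by rewrite lt_def B0 sumsq_ge0.
rewrite -subr_ge0 -(pmulr_rge0 _ Bgt0).
suff -> : B * (A * B - C ^+ 2)
    = B ^+ 2 * A - (B * C * C) *+ 2 + C ^+ 2 * B by exact: quad.
by ring.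
Qed.

Lemma euclid_distxx x : euclid_dist x x = 0.
Proof.
rewrite /euclid_dist big1 ?sqrtr0// => i _.
by rewrite subrr expr0n.
Qed.

Lemma euclid_dist_positivity x y : euclid_dist x y = 0 -> x = y.
Proof.
move=> /eqP; rewrite sqrtr_eq0 => le0; apply/rowP => i.
have : \sum_(i < n) (x ord0 i - y ord0 i) ^+ 2 == 0.
  by rewrite eq_le le0 sumsq_ge0.
rewrite psumr_eq0 => [/allP/(_ i)|j _]; last exact: sqr_ge0.
by rewrite mem_index_enum sqrf_eq0 subr_eq0 => /(_ isT)/eqP.
Qed.

Lemma euclid_dist_sym x y : euclid_dist x y = euclid_dist y x.
Proof.
by congr Num.sqrt; apply: eq_bigr => i _; rewrite -sqrrN opprB.
Qed.

Lemma euclid_dist_triangle y x z :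
  euclid_dist x z <= euclid_dist x y + euclid_dist y z.
Proof.
have sqrt_ge0 (u v : 'rV[R]_n) : 0 <= euclid_dist u v by exact: sqrtr_ge0.
rewrite -(@ler_pXn2r _ 2)// ?nnegrE ?addr_ge0//.
rewrite sqrrD !sqr_sqrtr//.
pose a i := x ord0 i - y ord0 i; pose b i := y ord0 i - z ord0 i.
have -> : \sum_i (x ord0 i - z ord0 i) ^+ 2
    = \sum_i a i ^+ 2 + (\sum_i a i * b i) *+ 2 + \sum_i b i ^+ 2.
  rewrite -sumrMnl -!big_split /=; apply: eq_bigr => i _.
  by rewrite -sqrrD /a /b addrA subrK.
rewrite lerD2r lerD2l lerMn2r/= -sqrtrM// (le_trans (ler_norm _))//.
by rewrite -sqrtr_sqr ler_wsqrtr// cauchy_schwarz.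
Qed.

HB.instance Definition _ := isMetric.Build R (euclid R n)
  euclid_distxx euclid_dist_positivity euclid_dist_sym euclid_dist_triangle.

End Euclid.

Section InducedMetric.
Variables (R : realType) (X : metricType R) (A : set X).

Let dist (x y : A) : R := mdist (set_val x) (set_val y).

Let dist_ge0 x y : 0 <= dist x y. Proof. exact: mdist_ge0. Qed.

Let dist_positivity x y : dist x y = 0 -> x = y.
Proof. by move=> /mdist_positivity/val_inj. Qed.

Let ballEdist x d : ball x d = [set y | dist x y < d].
Proof.
by rewrite {1}/ball/= /initial_ball ballEmdist.
Qed.

HB.instance Definition _ := PseudoMetric_isMetric.Build R (set_type A)
  dist_ge0 dist_positivity ballEdist.

End InducedMetric.

Section Smirnov.
Variables (R : realType) (X : metricType R).

Definition bounded_unif_continuous : set (X -> R) :=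
  [set f | bounded_fun f /\ unif_continuous f].

Definition smirnov_cube : topologicalType :=
  prod_topology (fun f : bounded_unif_continuous =>
    set_type `[inf (range (set_val f)), sup (range (set_val f))]).

Lemma smirnov_eval_subproof (x : X) (f : bounded_unif_continuous) :
  set_val f x \in `[inf (range (set_val f)), sup (range (set_val f))]%classic.
Proof.
have [bf _] := set_valP f; apply/mem_set; rewrite /= in_itv/=; apply/andP; split.
- by apply: ge_inf; [exact: bounded_fun_has_lbound|exists x].
- by apply: ub_le_sup; [exact: bounded_fun_has_ubound|exists x].
Qed.

Definition smirnov_eval (x : X) : smirnov_cube :=
  fun f => exist _ (set_val f x) (smirnov_eval_subproof x f).

Definition smirnov_compactification : set smirnov_cube :=
  closure (range smirnov_eval).

Definition smirnov_remainder : set smirnov_cube :=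
  smirnov_compactification `\` range smirnov_eval.

End Smirnov.

Arguments bounded_unif_continuous {R} X.
Arguments smirnov_cube {R} X.
Arguments smirnov_eval {R} X.
Arguments smirnov_compactification {R} X.
Arguments smirnov_remainder {R} X.

Section LargeInductiveDimension.

Definition partition_between (Y : topologicalType) (A B L : set Y) : Prop :=
  closed L /\
  exists U V : set Y, [/\ open U, open V, A `<=` U, B `<=` V &
    U `&` V = set0 /\ ~` L = U `|` V].

(** [Ind_lt Y m] is [Ind Y <= m - 1]; the shift makes room for dimension
    [-1]. *)
Fixpoint Ind_lt (Y : topologicalType) (m : nat) : Prop :=
  match m with
  | 0 => [set: Y] = set0
  | m'.+1 => forall A B : set Y, closed A -> closed B -> A `&` B = set0 ->
      exists L : set Y, partition_between A B L /\ Ind_lt (set_type L) m'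
  end.

Definition Ind_eq (Y : topologicalType) (m : nat) : Prop :=
  Ind_lt Y m.+1 /\ ~ Ind_lt Y m.

End LargeInductiveDimension.

Definition Zset (R : realType) (n k : nat) : set (euclid R n) :=
  [set x : 'rV[R]_n | (n - k <= #|[set i : 'I_n | x ord0 i \is a Num.int]|)%N].

Arguments Zset R n k : clear implicits.

(* Main.v *)
Require Import Defs.
From mathcomp Require Import all_boot all_order all_algebra.
From mathcomp Require Import all_classical all_reals all_analysis.
From mathcomp Require Import ring lra zify.

(** Write [X = Z_k^n] for the [k]-skeleton of the tiling of the space by unit
    cubes, and work inside the cube [T] that contains its Smirnov
    compactification; [T] is compact Hausdorff. Two subsets of [X] have
    disjoint closures in [T] if and only if they are at positive distance
    ([smirnov_proximity], [smirnov_separated]), so questions about closed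
    subsets of the remainder become metric questions about [X]. As bounded
    closed subsets of [X] are compact, the remainder is closed in [T] and its
    neighbourhoods contain all points of [X] far away.

    Upper bound ([Ind_lt_skel]). By induction on the dimension, every closed
    subspace of the closure of the [j]-skeleton of a cubical subdivision of mesh
    [1/N] has [Ind <= j]. Disjoint closed sets [A] and [B] have neighbourhoods
    whose traces on [X] are at some distance [d > 0]. Take cubes of diameter
    less than [d], with walls shifted off the grid of mesh [1/N], and cut the
    [j]-skeleton into the part covered by the cubes that meet the
    neighbourhood of [A], and the rest. The closures of the two parts meet only
    in the closure of the intersection of the [j]-skeleton with the shifted
    walls, which lies in the [(j-1)]-skeleton of a finer subdivision; this
    intersection of closures is the partition.

    Lower bound ([not_Ind_lt_smirnov_remainder]). If [Ind <= k - 1], then any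
    [k] pairs of disjoint closed sets can be separated by pairs of open sets
    [U_i], [V_i] that together cover the remainder ([Ind_lt_cover]). Apply this
    to the closures of the sets where the [i]-th coordinate is an even, or an
    odd, integer. The [U_i] and [V_i] then cover a whole unit [k]-cube of [X] far
    from the origin, while the traces of [U_i] and [V_i] on it are at positive
    distance. On a fine grid this contradicts the discrete Poincare-Miranda
    theorem [discrete_miranda], which is proved by applying Stokes' formula to
    a cup product of cochains modulo 2 on the cubical grid. *)

Set Implicit Arguments.
Unset Strict Implicit.
Unset Printing Implicit Defensive.

Import Order.TTheory GRing.Theory Num.Theory.
Import numFieldNormedType.Exports.

Local Open Scope ring_scope.

(** * A discrete Poincare-Miranda theorem *)

Lemma addFF (x : 'F_2) : x + x = 0.
Proof. by apply: addrr_pchar2; exact: pchar_Fp. Qed.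

Section Grid.
Variables (K N : nat).
Local Notation grid := {ffun 'I_K -> 'I_N.+2}.
Implicit Types (z : grid) (S : {set 'I_K}) (i l : 'I_K).

(** The indicator vector of [S].  Coordinates of a grid point are added in the
    cyclic group ['I_N.+2], so that translations are bijections of the grid; the
    cubes that matter have no coordinate equal to [ord_max] at their base point
    [z], and the points [z + corner S] are then the vertices of an actual unit
    cube. *)
Definition corner S : grid := [ffun l => (l \in S)%:R].

Lemma cornerE z S l : (z + corner S) l = z l + (l \in S)%:R.
Proof. by rewrite !ffunE. Qed.

Lemma corner_rem z S i : i \in S ->
  z + corner [set i] + corner (S :\ i) = z + corner S.
Proof.
move=> iS; apply/ffunP=> l; rewrite !cornerE !inE.
by case: eqVneq => [->|_] /=; rewrite ?iS ?addr0.
Qed.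

(** Each unordered pair is counted twice. *)
Lemma sum_sym_pchar2 S (f : 'I_K -> 'I_K -> 'F_2) :
  (forall l i, f l i = f i l) ->
  \sum_(l in S) \sum_(i in S :\ l) f l i = 0.
Proof.
move=> fC.
have split_sum : \sum_(l in S) \sum_(i in S :\ l) f l i =
    \sum_(l in S) \sum_(i in S | (i < l)%N) f l i +
    \sum_(l in S) \sum_(i in S | (l < i)%N) f l i.
  rewrite -big_split; apply: eq_bigr => l _ /=.
  rewrite (bigID (fun i : 'I_K => (i < l)%N)) /=; congr (_ + _);
    apply: eq_bigl => i; rewrite !inE; case: ltngtP => //=;
    rewrite ?andbT ?andbF //; last by move=> /val_inj ->; rewrite eqxx.
    by move=> il; rewrite -val_eqE /= neq_ltn il.
  by move=> il; rewrite -val_eqE /= neq_ltn il orbT.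
rewrite split_sum.
have -> : \sum_(l in S) \sum_(i in S | (l < i)%N) f l i =
    \sum_(l in S) \sum_(i in S | (i < l)%N) f l i.
  rewrite (exchange_big_dep (mem S)) /=; last by move=> l i _ /andP[].
  apply: eq_bigr => i iS; apply: eq_big => [l|l _]; last exact: fC.
  by rewrite iS.
exact: addFF.
Qed.

Lemma exchange_rem S (f : 'I_K -> 'I_K -> 'F_2) :
  \sum_(i in S) \sum_(l in S :\ i) f i l =
  \sum_(l in S) \sum_(i in S :\ l) f i l.
Proof.
rewrite (exchange_big_dep (mem S)) /=; last by move=> i l _; rewrite inE => /andP[].
apply: eq_bigr => l lS; apply: eq_bigl => i.
by rewrite !inE lS andbT andbC eq_sym.
Qed.

Variable v : nat -> grid -> 'F_2.

(** The value of the cup product [dv_0 \cup ... \cup dv_(j-1)] of the coboundaries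
    of the 0-cochains [v_0, ..., v_(j-1)] on the cube with base point [z] and
    directions [S], with coefficients in ['F_2]: the last edge of a monotone path
    through the cube is traversed in the direction [i].  It is meant for
    [#|S| = j], but no lemma below depends on this. *)
Fixpoint cup (j : nat) z S : 'F_2 :=
  if j is j'.+1 then
    \sum_(i in S) cup j' z (S :\ i) *
      (v j' (z + corner S) + v j' (z + corner (S :\ i)))
  else 1.

(** The cup product is a cocycle: it sums to zero over the facets of a cube. *)
Lemma cup_cocycle j z S :
  \sum_(i in S) cup j (z + corner [set i]) (S :\ i) =
  \sum_(i in S) cup j z (S :\ i).
Proof.
elim: j z S => [//|j IH] z S /=.
pose c l i := cup j z (S :\ l :\ i).
have cC l i : c l i = c i l by rewrite /c !finset.setDDl finset.setUC.
transitivity (\sum_(l in S) \sum_(i in S :\ l) c l i * v j (z + corner (S :\ l))).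
  transitivity (\sum_(l in S) \sum_(i in S :\ l)
     cup j (z + corner [set i]) (S :\ l :\ i) *
      (v j (z + corner S) + v j (z + corner (S :\ l)))).
    rewrite -exchange_rem; apply: eq_bigr => l lS; apply: eq_bigr => i.
    rewrite !inE => /andP[il iS].
    have -> : S :\ i :\ l = S :\ l :\ i by rewrite !finset.setDDl finset.setUC.
    by rewrite !corner_rem // !inE il iS.
  transitivity (\sum_(l in S) \sum_(i in S :\ l)
     (c l i * v j (z + corner S) + c l i * v j (z + corner (S :\ l)))).
    apply: eq_bigr => l lS; rewrite -big_distrl IH big_distrl /=.
    by apply: eq_bigr => i _; rewrite mulrDr.
  under eq_bigr do rewrite big_split.
  rewrite big_split /= sum_sym_pchar2 ?add0r // => l i.
  by rewrite cC.
transitivity (\sum_(l in S) \sum_(i in S :\ l)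
     (c l i * v j (z + corner (S :\ l)) +
      c l i * v j (z + corner (S :\ l :\ i)))).
  under [RHS]eq_bigr do rewrite big_split.
  rewrite big_split /= [X in _ + X]sum_sym_pchar2 ?addr0 // => l i.
  by rewrite cC !finset.setDDl finset.setUC.
by apply: eq_bigr => l _; apply: eq_bigr => i _; rewrite mulrDr.
Qed.

(** A cochain whose coboundary is [cup j.+1], namely [cup j \cup v_j]. *)
Definition cup_prim j z S := cup j z S * v j (z + corner S).

Lemma cup_exact j z S :
  cup j.+1 z S =
  \sum_(i in S) (cup_prim j (z + corner [set i]) (S :\ i) + cup_prim j z (S :\ i)).
Proof.
rewrite big_split /= /cup_prim.
have -> : \sum_(i in S) cup j (z + corner [set i]) (S :\ i) *
     v j (z + corner [set i] + corner (S :\ i)) =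
   \sum_(i in S) cup j z (S :\ i) * v j (z + corner S).
  rewrite -[RHS]big_distrl -cup_cocycle big_distrl /=.
  by apply: eq_bigr => i iS; rewrite corner_rem.
by rewrite -big_split; apply: eq_bigr => i _; rewrite mulrDr.
Qed.

Lemma cup_neq0 j z S : cup j z S != 0 ->
  forall l, (l < j)%N -> exists S1 S2 : {set 'I_K}, [/\ S1 \subset S, S2 \subset S &
     v l (z + corner S1) != v l (z + corner S2)].
Proof.
elim: j S => [//|j IH] S nz l.
have [i iS] : exists2 i, i \in S & cup j z (S :\ i) *
    (v j (z + corner S) + v j (z + corner (S :\ i))) != 0.
  apply/exists_inP; apply: contraNT nz; rewrite negb_exists_in => /forall_inP h.
  by rewrite /= big1 // => i iS; apply/eqP; rewrite -[_ == _]negbK; exact: h.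
rewrite mulf_eq0 negb_or => /andP[cnz vnz].
have sSi : S :\ i \subset S by exact: subsetDl.
rewrite ltnS leq_eqVlt => /orP[/eqP ->|lj].
  exists S, (S :\ i); split=> //; apply: contraNneq vnz => ->.
  by rewrite addFF.
have [S1 [S2 [s1 s2 h]]] := IH _ cnz _ lj.
by exists S1, S2; split=> //; exact: fintype.subset_trans sSi.
Qed.

(** Summation of a discrete derivative in the direction [i]: only the two
    boundary faces survive. *)
Lemma sum_translate (Q : pred grid) i (f : grid -> 'F_2) :
  (forall z, Q (z + corner [set i]) = Q z) ->
  \sum_(z | Q z && (z i != ord_max)) (f (z + corner [set i]) + f z) =
  \sum_(z | Q z && (z i == ord_max)) f z + \sum_(z | Q z && (z i == 0)) f z.
Proof.
move=> QT.
have shift : \sum_(z | Q z && (z i != ord_max)) f (z + corner [set i]) =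
    \sum_(z | Q z && (z i != 0)) f z.
  rewrite [RHS](reindex (fun z => z + corner [set i])) /=; last first.
    by exists (fun z => z - corner [set i]) => z _; rewrite ?addrK ?subrK.
  apply: eq_bigl => z; rewrite QT; congr (_ && ~~ _).
  rewrite cornerE inE eqxx addr_eq0; congr (_ == _); apply/val_inj => /=.
  by rewrite !modn_small // subn1.
have compl (p : pred grid) : \sum_(z | Q z && ~~ p z) f z =
    \sum_(z | Q z) f z + \sum_(z | Q z && p z) f z.
  by rewrite [X in _ = X + _](bigID p) /= addrAC addFF add0r.
rewrite big_split /= shift !compl addrACA addFF add0r.
exact: addrC.
Qed.

(** Base points of the [j]-dimensional unit cubes that lie in the face of the
    grid where the coordinates from [j] on are equal to [ord_max]. *)
Definition box j : pred grid := fun z =>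
  [forall l : 'I_K, if (l < j)%N then z l != ord_max else z l == ord_max].

(** The directions of those cubes. *)
Definition initial j : {set 'I_K} := [set l : 'I_K | (l < j)%N].

Hypothesis v0 : forall (l : 'I_K) z, z l = 0 -> v l z = 0.
Hypothesis v1 : forall (l : 'I_K) z, z l = ord_max -> v l z = 1.

(** Stokes' formula for [cup_prim].  In a face orthogonal to a direction [i < j]
    the function [v_i] is constant, so the cup product vanishes there; on the face
    [z_j = 0] the factor [v_j] vanishes; the face where [z_j] is maximal contributes
    the sum for [j], on which [v_j] is 1. *)
Lemma sum_cup_box j : (j <= K)%N ->
  \sum_(z | box j z) cup j z (initial j) = 1.
Proof.
elim: j => [_|j IH jK].
  rewrite (big_pred1 [ffun => ord_max]) //= => z.
  apply/forallP/eqP => [h|-> l]; last by rewrite ffunE.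
  by apply/ffunP => l; rewrite ffunE; apply/eqP/h.
(* [Q i] is the condition of [box j.+1] on the coordinates other than [i]. *)
pose Q i : pred grid := fun z => [forall l : 'I_K, (l != i) ==>
  if (l < j.+1)%N then z l != ord_max else z l == ord_max].
have QT i z : Q i (z + corner [set i]) = Q i z.
  apply: eq_forallb => l; case: eqVneq => //= li.
  by rewrite cornerE inE (negbTE li) addr0.
have boxQ i z : i \in initial j.+1 -> box j.+1 z = Q i z && (z i != ord_max).
  rewrite inE => ij; apply/forallP/andP => [h|[/forallP h zi] l].
    split; last by have := h i; rewrite ij.
    by apply/forallP => l; apply/implyP => _; exact: h.
  by have := h l; case: eqVneq => [->|] //=; rewrite ij.
under eq_bigr do rewrite cup_exact.
rewrite exchange_big /=.
pose i0 : 'I_K := Ordinal jK.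
have i0in : i0 \in initial j.+1 by rewrite inE /=.
have face i : i \in initial j.+1 ->
  \sum_(z | box j.+1 z) (cup_prim j (z + corner [set i]) (initial j.+1 :\ i) +
     cup_prim j z (initial j.+1 :\ i)) = (i == i0)%:R.
  move=> iin; rewrite (eq_bigl _ _ (fun z => boxQ i z iin)).
  rewrite sum_translate; last exact: QT.
  have const z (S : {set 'I_K}) : S \subset initial j.+1 :\ i ->
      (z + corner S) i = z i.
    move=> /fintype.subsetP sS; rewrite cornerE; case: (boolP (i \in S)) => [/sS|].
      by rewrite !inE eqxx.
    by rewrite addr0.
  have [ii0|ii0] := eqVneq i i0; last first.
    have ij : (i < j)%N.
      by move: iin ii0; rewrite inE ltnS leq_eqVlt -val_eqE => /orP[->|].
    have van z : (z i == ord_max) || (z i == 0) ->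
        cup_prim j z (initial j.+1 :\ i) = 0.
      move=> zi; rewrite /cup_prim.
      suff /eqP -> : cup j z (initial j.+1 :\ i) == 0 by rewrite mul0r.
      apply/negP => /negP /cup_neq0 /(_ _ ij) [S1 [S2 [s1 s2 /eqP]]]; apply.
      case/orP: zi => /eqP zi; first by rewrite !v1 ?const.
      by rewrite !v0 ?const.
    rewrite big1 ?add0r; last by move=> z /andP[_ zi]; apply: van; rewrite zi.
    by apply: big1 => z /andP[_ zi]; apply: van; rewrite zi orbT.
  move: const; rewrite ii0 => const.
  rewrite [X in _ + X]big1 ?addr0; last first.
    move=> z /andP[_ /eqP zi]; rewrite /cup_prim (_ : j = i0) // v0 ?mulr0 //.
    by rewrite const // zi.
  rewrite -(IH (ltnW jK)); apply: eq_big => [z|z /andP[_ /eqP zi]];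
    last rewrite /cup_prim.
    apply/andP/forallP => [[/forallP h zi] l|h].
      have := h l; case: (eqVneq l i0) => [-> _|]; first by rewrite /= ltnn.
      by rewrite ltnS -val_eqE /= leq_eqVlt => /negbTE ->.
    split; last by have := h i0; rewrite /= ltnn.
    apply/forallP => l; apply/implyP => li0.
    have := h l; move: li0; rewrite -val_eqE /= => /negbTE li0.
    by rewrite [(l < j.+1)%N]ltnS [(l <= j)%N]leq_eqVlt li0.
  have -> : v j (z + corner (initial j.+1 :\ i0)) = 1.
    by rewrite (_ : j = i0) // v1 // const.
  rewrite mulr1; congr cup; apply/finset.setP => l; rewrite !inE ltnS -val_eqE /=.
  by case: ltngtP.
under eq_bigr => i iin do rewrite face //.
rewrite (bigD1 i0) //= eqxx big1 ?addr0 // => i /andP[_ /negbTE ->].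
by [].
Qed.

End Grid.

(** Discrete Poincare-Miranda theorem: if each [u_l] is false on the face
    [z_l = 0] of the grid and true on the opposite face, then some unit cube
    carries both values of every [u_l]. *)
Theorem discrete_miranda (K N : nat) (u : 'I_K -> {ffun 'I_K -> 'I_N.+2} -> bool) :
  (forall l (z : {ffun 'I_K -> 'I_N.+2}), z l = 0 -> u l z = false) ->
  (forall l (z : {ffun 'I_K -> 'I_N.+2}), z l = ord_max -> u l z = true) ->
  exists2 z : {ffun 'I_K -> 'I_N.+2}, (forall l, z l != ord_max) &
    forall l, exists S1 S2 : {set 'I_K},
      u l (z + corner N S1) = false /\ u l (z + corner N S2) = true.
Proof.
move=> u0 u1.
pose v (l : nat) (z : {ffun 'I_K -> 'I_N.+2}) : 'F_2 :=
  if insub l is Some l' then (u l' z)%:R else 0.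
have vE (l : 'I_K) z : v l z = (u l z)%:R by rewrite /v valK.
have v0 (l : 'I_K) (z : {ffun 'I_K -> 'I_N.+2}) : z l = 0 -> v l z = 0.
  by move=> zl; rewrite vE u0.
have v1 (l : 'I_K) (z : {ffun 'I_K -> 'I_N.+2}) : z l = ord_max -> v l z = 1.
  by move=> zl; rewrite vE u1.
have s1 := sum_cup_box v0 v1 (leqnn K).
have [z zb nz] : exists2 z, box K z & cup v K z (initial K K) != 0.
  apply/exists_inP; apply: contraT; rewrite negb_exists_in => /forall_inP h.
  move: s1; rewrite big1 => [/eqP|z zb]; first by [].
  by apply/eqP; rewrite -[_ == _]negbK; exact: h.
exists z => [l|l]; first by have /forallP /(_ l) := zb; rewrite ltn_ord.
have [S1 [S2 [_ _]]] := cup_neq0 nz (ltn_ord l).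
rewrite !vE; case E1: (u l _); case E2: (u l _); rewrite ?eqxx // => _.
  by exists S2, S1.
by exists S1, S2.
Qed.

Local Open Scope classical_set_scope.
Local Open Scope ring_scope.

(** * Separation and the large inductive dimension *)

(** Normality, in the equivalent form where the separating open sets have
    disjoint closures. *)
Definition strongly_normal (T : topologicalType) := forall A B : set T,
  closed A -> closed B -> A `&` B = set0 -> exists U V : set T,
  [/\ open U, open V, A `<=` U, B `<=` V & closure U `&` closure V = set0].

Lemma compact_hausdorff_strongly_normal (T : topologicalType) :
  hausdorff_space T -> compact [set: T] -> strongly_normal T.
Proof.
move=> hT cT A B cA cB AB0; have nT := compact_normal hT cT.
have sub (C D : set T) : closed C -> open D -> C `<=` D ->
    exists U, [/\ open U, C `<=` U & closure U `<=` D].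
  move=> cC oD CD.
  have nD : set_nbhs C D by apply/set_nbhsP; exists D; split.
  have [U nU UD] := nT C cC D nD.
  have /set_nbhsP[W [oW CW WU]] := nU.
  by exists W; split=> //; apply: subset_trans UD; exact: closureS.
have [U [oU AU UB]] := sub A (~` B) cA (closed_openC cB) ((disjoints_subset A B).1 AB0).
have [V [oV BV VU]] : exists V, [/\ open V, B `<=` V & closure V `<=` ~` closure U].
  apply: sub => //; first by apply: closed_openC; exact: closed_closure.
  by move=> x Bx /UB.
exists U, V; split=> //; apply/disjoints_subset => x Ux /VU.
exact.
Qed.

Section ClosedEmbedding.
Variable T : topologicalType.

(** A homeomorphism onto a closed subspace. Spaces whose dimension is studied
    are given together with a closed embedding in a fixed space [T], so that
    separation can always be done in [T]. *)
Definition closed_embedding (Z : topologicalType) (f : Z -> T) :=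
  [/\ injective f, continuous f & forall C, closed C -> closed (f @` C)].

Lemma set_val_closed (L : set T) : closed L -> forall C : set (set_type L),
  closed C -> closed (set_val @` C).
Proof.
move=> cL C cC; have [D oD DE] : open (~` C) by exact: closed_openC.
suff -> : set_val @` C = L `&` ~` D by apply: closedI => //; exact: open_closedC.
apply/seteqP; split=> [_ [x Cx <-]|x [Lx Dx]].
  split; first exact: set_valP.
  by move=> Dx; have : (set_val @^-1` D) x by []; rewrite DE.
exists (exist _ x (mem_set Lx)) => //; apply: contrapT => nC.
by have : (~` C) (exist _ x (mem_set Lx)) by []; rewrite -DE.
Qed.

Lemma closed_embedding_set_val (L : set T) :
  closed L -> closed_embedding (set_val : set_type L -> T).
Proof.
move=> cL; split; [exact: val_inj|exact: initial_continuous|exact: set_val_closed].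
Qed.
End ClosedEmbedding.

Lemma closed_embedding_restr (T Z : topologicalType) (f : Z -> T) (L : set Z) :
  closed L -> closed_embedding f ->
  closed_embedding (f \o set_val : set_type L -> T).
Proof.
move=> /closed_embedding_set_val [vi vc vcl] [fi fc fcl]; split.
- exact: inj_comp.
- by move=> x; apply: continuous_comp; [exact: vc|exact: fc].
- by move=> C cC; rewrite -image_comp; apply/fcl/vcl.
Qed.

(** If [Ind Z <= m - 1], then [m] pairs of disjoint closed sets of the ambient
    space can be separated by pairs of open sets that together cover [Z].  A
    partition [L] for the last pair is covered by the pairs given by induction,
    and what remains of the two sides of [L] is a pair of disjoint closed sets. *)
Lemma Ind_lt_cover (T : topologicalType) : strongly_normal T ->
  forall (m : nat) (Z : topologicalType) (f : Z -> T) (A B : nat -> set T),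
  closed_embedding f -> Ind_lt Z m ->
  (forall i, closed (A i)) -> (forall i, closed (B i)) ->
  (forall i, (i < m)%N -> A i `&` B i = set0) ->
  exists U V : nat -> set T,
   (forall i, (i < m)%N -> [/\ open (U i), open (V i), A i `<=` U i, B i `<=` V i &
      closure (U i) `&` closure (V i) = set0]) /\
   (forall z, exists2 i, (i < m)%N & (U i `|` V i) (f z)).
Proof.
move=> nT; elim=> [|m IH] Z f A B fE /=.
  move=> Z0 _ _ _; exists (fun=> set0), (fun=> set0); split=> // z.
  by have : [set: Z] z by []; rewrite Z0.
move=> Zm cA cB AB0; have [fi fc fcl] := fE.
have AmBm0 : f @^-1` A m `&` f @^-1` B m = set0.
  by rewrite -preimage_setI AB0 // preimage_set0.
have [L [[cL [U [V [oU oV AU BV [UV0 UVL]]]]] Lm]] :=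
  Zm (f @^-1` A m) (f @^-1` B m) ((continuous_closedP f).1 fc _ (cA m))
   ((continuous_closedP f).1 fc _ (cB m)) AmBm0.
have [U' [V' [UV'P UV'c]]] := IH _ (f \o set_val) A B
  (closed_embedding_restr cL fE) Lm cA cB (fun i im => AB0 i (ltnW im)).
pose O := \bigcup_(i in [set i | (i < m)%N]) (U' i `|` V' i).
have oO : open O.
  by apply: bigcup_open => i /UV'P[? ? _ _ _]; exact: openU.
have UVT z : L z \/ U z \/ V z.
  have [?|nL] := pselect (L z); [by left|right].
  by have : (~` L) z by []; rewrite UVL.
have Lcov z : L z -> O (f z).
  by move=> Lz; have [i im ?] := UV'c (exist _ z (mem_set Lz)); exists i.
have cF (W W' : set Z) : open W' -> (forall z, ~ O (f z) -> W z <-> ~ W' z) ->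
    closed (f @` [set z | W z /\ ~ O (f z)]).
  move=> oW' WW'; apply: fcl.
  have -> : [set z | W z /\ ~ O (f z)] = ~` W' `&` ~` (f @^-1` O).
    by apply/seteqP; split=> z [h1 h2]; split=> //; apply/(WW' z h2).
  apply: closedI; apply: open_closedC => //.
  by move/continuousP: fc; apply.
have disj z : U z -> V z -> False.
  by move=> Uz Vz; have : (U `&` V) z by []; rewrite UV0.
have UVnO z : ~ O (f z) -> U z \/ V z.
  by move=> nO; case: (UVT z) => // /Lcov.
have [Um [Vm [oUm oVm FU HV UVm0]]] : exists Um Vm : set T, [/\ open Um, open Vm,
    A m `|` f @` [set z | U z /\ ~ O (f z)] `<=` Um,
    B m `|` f @` [set z | V z /\ ~ O (f z)] `<=` Vm &
    closure Um `&` closure Vm = set0].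
  apply: nT.
  - apply: closedU => //; apply: (cF U V) => // z /UVnO UVz; split; last by case: UVz.
    by move=> Uz Vz; exact: (disj z).
  - apply: closedU => //; apply: (cF V U) => // z /UVnO UVz; split; last by case: UVz.
    by move=> Vz Uz; exact: (disj z).
  - rewrite -subset0 => t [[At|[z [Uz _] zt]] [Bt|[z' [Vz' _] zt']]].
    + by have : (A m `&` B m) t by []; rewrite AB0.
    + by apply: (disj z') => //; apply: AU; rewrite /= zt'.
    + by apply: (disj z) => //; apply: BV; rewrite /= zt.
    + by apply: (disj z) => //; rewrite (_ : z = z') //; apply: fi; rewrite zt.
exists (fun i => if i == m then Um else U' i), (fun i => if i == m then Vm else V' i).
split=> [i|z].
  rewrite ltnS leq_eqVlt; have [->|_ /=] := eqVneq i m; last exact: UV'P.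
  split=> //; apply: subset_trans; try exact: FU; try exact: HV.
    by move=> ? ?; left.
  by move=> ? ?; left.
have [[i im Oi]|nO] := pselect (O (f z)).
  by exists i; [exact: ltnW|rewrite (ltn_eqF im)].
exists m => //; rewrite eqxx.
by case: (UVnO z nO) => ?; [left; apply: FU|right; apply: HV]; right; exists z.
Qed.

(** * Smirnov compactifications of metric spaces *)

Lemma compact_set_type (T : topologicalType) (A : set T) :
  compact A -> compact [set: set_type A].
Proof.
move=> cA F PF _.
have [p [Ap clp]] : A `&` cluster (set_val @ F) !=set0.
  apply: cA; rewrite /fmap /=; apply: filterS filterT => x _; exact: set_valP.
exists (exist _ p (mem_set Ap)); split=> // B C FB.
move=> [_ [[D oD <-] Dp] DC].
have [_ [[x Bx <-] Dx]] : set_val @` B `&` D !=set0.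
  apply: clp; last exact: open_nbhs_nbhs.
  by rewrite /fmap /=; apply: filterS FB => x Bx; exists x.
by exists x; split=> //; exact: DC.
Qed.

Lemma hausdorff_set_type (T : topologicalType) (A : set T) :
  hausdorff_space T -> hausdorff_space (set_type A).
Proof.
move=> hT p q pq; apply: val_inj; apply: hT => B C nB nC.
have [x [Bx Cx]] := pq _ _ (@initial_continuous _ _ set_val p B nB)
  (@initial_continuous _ _ set_val q C nC).
by exists (set_val x).
Qed.

Section Smirnov.
Variables (R : realType) (X : metricType R).
Local Notation T := (@smirnov_cube R X).
Local Notation e := (@smirnov_eval R X).
Local Notation buc := (bounded_unif_continuous X).

Lemma smirnov_cube_compact : compact [set: T].
Proof.
have := tychonoff (fun f : buc => compact_set_type
  (@segment_compact R (inf (range (set_val f))) (sup (range (set_val f))))).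
by congr compact; apply/seteqP; split.
Qed.

Lemma smirnov_cube_hausdorff : hausdorff_space T.
Proof.
apply: hausdorff_product => f; apply: hausdorff_set_type.
exact: order_hausdorff.
Qed.

Lemma smirnov_cube_normal : strongly_normal T.
Proof.
exact: compact_hausdorff_strongly_normal smirnov_cube_hausdorff smirnov_cube_compact.
Qed.

(** The real-valued coordinate of index [f] in the cube. *)
Definition coord (f : buc) (t : T) : R := set_val (t f).

Lemma coord_continuous f : continuous (coord f).
Proof.
move=> t; apply: (@continuous_comp _ _ _ (fun t : T => t f) set_val).
  exact: (@proj_continuous _ _ f).
exact: initial_continuous.
Qed.

Lemma coord_inj (s t : T) : (forall f, coord f s = coord f t) -> s = t.
Proof.
move=> st; apply: functional_extensionality_dep => f.
by apply: val_inj; exact: st.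
Qed.

Lemma coord_eval f x : coord f (e x) = set_val f x.
Proof. by []. Qed.

Lemma bucP (f : buc) (eps : R) : 0 < eps -> exists2 d, 0 < d &
  forall x y, mdist x y < d -> `|set_val f x - set_val f y| < eps.
Proof.
move=> eps0; have [_ /unif_continuousP /(_ _ eps0)[d d0 h]] := set_valP f.
exists d => // x y xy.
have := h (x, y); rewrite /= ballEmdist /= => /(_ xy).
by [].
Qed.

Lemma lipschitz_buc (f : X -> R) (M : R) : (forall x, `|f x| <= M) ->
  (forall x y, `|f x - f y| <= mdist x y) -> buc f.
Proof.
move=> fM fL; split.
  exists M; split; first exact: num_real.
  by move=> N MN x _; apply: le_trans (fM x) (ltW MN).
apply/unif_continuousP => eps eps0; exists eps => // -[x y] /=.
rewrite ballEmdist /= => xy.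
by apply: le_lt_trans (fL x y) xy.
Qed.

(** Sets with disjoint closures in the cube have uniformly separated traces on
    [X]: a cluster point of pairs whose distance tends to zero lies on the
    diagonal, because the coordinates are uniformly continuous. *)
Lemma smirnov_proximity (P Q : set T) : closure P `&` closure Q = set0 ->
  exists2 d : R, 0 < d & forall x y, P (e x) -> Q (e y) -> d <= mdist x y.
Proof.
move=> PQ0; apply: contrapT => nd.
have /choice[xy xyP] : forall m : nat, exists xy : X * X,
    [/\ P (e xy.1), Q (e xy.2) & mdist xy.1 xy.2 < m.+1%:R^-1].
  move=> m; apply: contrapT => nm; apply: nd; exists m.+1%:R^-1 => // x y Px Qy.
  by rewrite leNgt; apply/negP => xym; apply: nm; exists (x, y).
pose g (m : nat) : T * T := (e (xy m).1, e (xy m).2).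
have cTT : compact ([set: T] `*` [set: T]).
  by apply: compact_setX; exact: smirnov_cube_compact.
have [[p q] [_ pq]] : ([set: T] `*` [set: T]) `&` cluster (g @ \oo) !=set0.
  by apply: cTT; apply: filterS filterT.
have pE : p = q.
  apply: coord_inj => f; apply/eqP; rewrite -subr_eq0 -normr_eq0.
  apply/negPn; apply/negP => pq0.
  pose eps := `|coord f p - coord f q| / 3.
  have eps0 : 0 < eps by rewrite divr_gt0 // lt_def pq0 normr_ge0.
  have [d d0 dP] := bucP f eps0.
  have [N Nd] : exists N : nat, N.+1%:R^-1 < d.
    have := archi_boundP (ltW (_ : 0 < d^-1)); rewrite invr_gt0 => /(_ d0) h.
    exists (Num.bound d^-1); rewrite invf_plt ?posrE //.
    by apply: lt_le_trans h _; rewrite ler_nat.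
  have nb (t : T) : nbhs t [set s | `|coord f t - coord f s| < eps].
    by have /cvgrPdist_lt /(_ _ eps0) := @coord_continuous f t.
  have [_ [[m Nm <-] [/= h1 h2]]] : [set g m | m in [set m | (N <= m)%N]] `&`
      [set st | `|coord f p - coord f st.1| < eps /\ `|coord f q - coord f st.2| < eps]
      !=set0.
    apply: pq; first by exists N => // m /= Nm; exists m.
    by exists ([set s | `|coord f p - coord f s| < eps],
      [set s | `|coord f q - coord f s| < eps]) => //; split; exact: nb.
  have [_ _ h3] := xyP m.
  have h4 : `|coord f (e (xy m).1) - coord f (e (xy m).2)| < eps.
    apply: dP; apply: (lt_trans h3); apply: le_lt_trans Nd.
    by rewrite lef_pV2 ?posrE // ler_nat.
  have h5 := ler_distD (coord f (e (xy m).1)) (coord f p) (coord f q).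
  have h6 := ler_distD (coord f (e (xy m).2)) (coord f (e (xy m).1)) (coord f q).
  rewrite (distrC (coord f (e (xy m).2)) (coord f q)) in h6.
  have h7 : `|coord f p - coord f q| = eps * 3 by rewrite /eps divfK.
  by move: h1 h2; rewrite /=; lra.
suff : (closure P `&` closure Q) p by rewrite PQ0.
split=> B nB.
  have [_ [[m _ <-] /= Bm]] : [set g m | m in setT] `&` [set st | B st.1] !=set0.
    apply: pq; first by exists 0%N => // m _; exists m.
    by exists (B, setT) => [|[s t] [/=]] //; split=> //; exact: filterT.
  by exists (e (xy m).1); split=> //; have [] := xyP m.
have [_ [[m _ <-] /= Bm]] : [set g m | m in setT] `&` [set st | B st.2] !=set0.
  apply: pq; first by exists 0%N => // m _; exists m.
  exists (setT, B) => [|[s t] [/=]] //; split=> //; first exact: filterT.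
  by rewrite /= -pE.
by exists (e (xy m).2); split=> //; have [] := xyP m.
Qed.

(** The distance to [A], truncated at 1. *)
Definition tdist (A : set X) (x : X) : R := inf [set Num.min 1 (mdist x a) | a in A].

Section tdist.
Variables (A : set X) (A0 : A !=set0).

Lemma tdist_lb x : has_lbound [set Num.min 1 (mdist x a) | a in A].
Proof. by exists 0 => _ [a _ <-]; rewrite le_min ler01 mdist_ge0. Qed.

Lemma tdist_le x a : A a -> tdist A x <= Num.min 1 (mdist x a).
Proof. by move=> Aa; apply: ge_inf; [exact: tdist_lb|exists a]. Qed.

Lemma tdist_ge x (r : R) : r <= 1 -> (forall a, A a -> r <= mdist x a) -> r <= tdist A x.
Proof.
move=> r1 rA; apply: lb_le_inf.
  by have [a Aa] := A0; exists (Num.min 1 (mdist x a)), a.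
by move=> _ [a Aa <-]; rewrite le_min r1 rA.
Qed.

Lemma tdist_lip x y : tdist A x - mdist x y <= tdist A y.
Proof.
apply: tdist_ge => [|a Aa]; rewrite lerBlDr.
  have [a Aa] := A0; apply: le_trans (tdist_le x Aa) _.
  by rewrite ge_min lerDl mdist_ge0.
apply: le_trans (tdist_le x Aa) _; rewrite ge_min; apply/orP; right.
by rewrite addrC; exact: metric_triangle.
Qed.

Lemma tdist_buc : buc (tdist A).
Proof.
apply: (@lipschitz_buc _ 1) => [x|x y].
  rewrite ger0_norm; last by apply: tdist_ge => // a _; exact: mdist_ge0.
  by have [a Aa] := A0; apply: le_trans (tdist_le x Aa) _; rewrite ge_min lexx.
have h1 := tdist_lip x y; have h2 := tdist_lip y x.
rewrite metric_sym in h2.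
by rewrite ler_norml; apply/andP; split; lra.
Qed.
End tdist.

(** Converse of [smirnov_proximity]: uniformly separated subsets of [X] have
    disjoint closures. *)
Lemma smirnov_separated (A B : set X) (d : R) : 0 < d ->
  (forall x y, A x -> B y -> d <= mdist x y) ->
  closure (e @` A) `&` closure (e @` B) = set0.
Proof.
move=> d0 AB.
have [->|A0] := eqVneq A set0; first by rewrite image_set0 closure0 set0I.
move/set0P in A0.
pose f : buc := exist _ (tdist A) (mem_set (tdist_buc A0)).
pose r := Num.min 1 d; have r0 : 0 < r by rewrite lt_min ltr01.
have cA : closure (e @` A) `<=` coord f @^-1` [set v | v <= 0].
  rewrite [X in _ `<=` X](closure_id _).1; last first.
    by apply: (continuous_closedP _).1; [exact: coord_continuous|exact: closed_le].
  apply: closureS => _ [x Ax <-]; rewrite /= coord_eval /=.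
  by apply: le_trans (tdist_le x Ax) _; rewrite mdistxx ge_min lexx orbT.
have cB : closure (e @` B) `<=` coord f @^-1` [set v | r <= v].
  rewrite [X in _ `<=` X](closure_id _).1; last first.
    by apply: (continuous_closedP _).1; [exact: coord_continuous|exact: closed_ge].
  apply: closureS => _ [x Bx <-]; rewrite /= coord_eval /=.
  apply: tdist_ge => // [|a Aa]; first by rewrite ge_min lexx.
  rewrite metric_sym; apply: le_trans (AB _ _ Aa Bx).
  by rewrite ge_min lexx orbT.
rewrite -subset0 => t [/cA /= h1 /cB /= h2].
by have := le_trans h2 h1; rewrite leNgt r0.
Qed.

Section Remainder.
Variable x0 : X.
(* Every point of [T] adherent to a ball of [X] belongs to [X]; this holds when
   the closed balls of [X] are compact. *)
Hypothesis bounded_complete : forall (r : R) (y : T),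
  closure (e @` [set x | mdist x0 x <= r]) y -> range e y.

(** The remainder consists of the points of the compactification at infinity. *)
Lemma smirnov_remainderE :
  smirnov_remainder X = \bigcap_(r in [set: R]) closure (e @` [set x | r < mdist x0 x]).
Proof.
apply/seteqP; split=> [y [cy ny] r _|y hy].
  have : closure (e @` [set x | mdist x0 x <= r] `|` e @` [set x | r < mdist x0 x]) y.
    apply: closureS cy => _ [x _ <-].
    by have [h|h] := leP (mdist x0 x) r; [left|right]; exists x.
  by rewrite closureU => -[/bounded_complete|].
split; first by apply: closureS (hy 0 I) => _ [x _ <-]; exists x.
move=> [x _ xy].
pose r := mdist x0 x + 1.
have : (closure (e @` [set x]) `&` closure (e @` [set x' | r < mdist x0 x'])) y.
  split; last exact: hy.
  by apply: subset_closure; exists x.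
rewrite (@smirnov_separated _ _ 1) // => _ x' -> /= h.
have := metric_triangle x0 x x'; rewrite /r in h.
by lra.
Qed.

Lemma closed_smirnov_remainder : closed (smirnov_remainder X).
Proof.
rewrite smirnov_remainderE; apply: closed_bigI => r _; exact: closed_closure.
Qed.

(** A neighbourhood of the remainder contains all points of [X] far away. *)
Lemma smirnov_remainder_nbhs (O : set T) : open O -> smirnov_remainder X `<=` O ->
  exists r : R, forall x, r < mdist x0 x -> O (e x).
Proof.
move=> oO YO; apply: contrapT => nr.
have /choice[x xP] : forall m : nat, exists x, m%:R < mdist x0 x /\ ~ O (e x).
  move=> m; apply: contrapT => nm; apply: nr; exists m%:R => x mx.
  by apply: contrapT => nO; apply: nm; exists x.
have [p [_ clp]] : [set: T] `&` cluster ((e \o x) @ \oo) !=set0.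
  by apply: smirnov_cube_compact; apply: filterS filterT.
suff : O p.
  move=> Op; have [_ [[m _ <-] Om]] : [set e (x m) | m in setT] `&` O !=set0.
    apply: clp; last exact: open_nbhs_nbhs.
    by exists 0%N => // m _; exists m.
  by have [_] := xP m.
apply: YO; rewrite smirnov_remainderE => r _ B nB.
have [N rN] : exists N : nat, r < N%:R.
  exists (Num.bound `|r|); apply: le_lt_trans (ler_norm _) _.
  exact: archi_boundP.
have [_ [[m Nm <-] Bm]] : [set e (x m) | m in [set m | (N <= m)%N]] `&` B !=set0.
  by apply: clp => //; exists N => // m /= Nm; exists m.
exists (e (x m)); split=> //; exists (x m) => //=.
have [h _] := xP m; apply: lt_trans rN _; apply: le_lt_trans h.
by rewrite ler_nat.
Qed.

End Remainder.
End Smirnov.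

(** * The skeleton as a metric space *)

(** Numbers with different integer parts have an integer between them. *)
Lemma floor_neq_between (R : realType) (a b : R) :
  Num.floor a != Num.floor b ->
  exists c : int, `|a - c%:~R| <= `|a - b|.
Proof.
wlog ab : a b / a <= b => [hw|] abn.
  have [ab|/ltW ba] := leP a b; first exact: hw.
  have [|c hc] := hw b a ba; first by rewrite eq_sym.
  exists (Num.floor a).
  have h3 : (Num.floor a)%:~R <= a by exact: floor_le.
  have h4 : b <= (Num.floor a)%:~R.
    have := le_floor ba; rewrite le_eqVlt eq_sym (negbTE abn) /= floor_lt_int.
    exact: ltW.
  by rewrite !ger0_norm ?subr_ge0 // lerD2l lerN2.
exists (Num.floor b).
have h3 : (Num.floor b)%:~R <= b by exact: floor_le.
have h4 : a <= (Num.floor b)%:~R.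
  have := le_floor ab; rewrite le_eqVlt (negbTE abn) /= floor_lt_int.
  exact: ltW.
by rewrite !ler0_norm ?subr_le0 // lerN2 lerD2l lerN2.
Qed.

Lemma min_lip (R : realDomainType) (a u v : R) :
  `|Num.min a u - Num.min a v| <= `|u - v|.
Proof.
wlog uv : u v / u <= v => [hw|].
  by have [|/ltW] := leP u v => /hw //; rewrite distrC [leRHS]distrC.
have muv : Num.min a u <= Num.min a v by rewrite le_min !ge_min lexx uv /= orbT.
rewrite !ler0_norm ?subr_le0 // !opprB.
by case: (leP a u) => au; case: (leP a v) => av; lra.
Qed.

Lemma max_lip (R : realDomainType) (a u v : R) :
  `|Num.max a u - Num.max a v| <= `|u - v|.
Proof.
wlog uv : u v / u <= v => [hw|].
  by have [|/ltW] := leP u v => /hw //; rewrite distrC [leRHS]distrC.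
have muv : Num.max a u <= Num.max a v by rewrite ge_max !le_max lexx uv /= orbT.
rewrite !ler0_norm ?subr_le0 // !opprB.
by case: (leP a u) => au; case: (leP a v) => av; lra.
Qed.

Section Skeleton.
Variables (R : realType) (n k : nat).
Hypothesis n_gt0 : (0 < n)%N.
Local Notation X := (set_type (Zset R n k)).
Local Notation T := (@smirnov_cube R X).
Local Notation e := (@smirnov_eval R X).
Local Notation buc := (bounded_unif_continuous X).

Lemma ZsetE (x : 'rV[R]_n) :
  Zset R n k x <-> (n - k <= #|[pred i | x ord0 i \is a Num.int]|)%N.
Proof.
rewrite /Zset /= (@eq_card _ _ [pred i | x ord0 i \is a Num.int]) // => i.
by rewrite [RHS]inE; apply/idP/idP => [/set_mem|h] //; exact: mem_set.
Qed.

(** The coordinates of a point of the skeleton, and the converse construction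
    [mkX] of a point from its coordinates. *)
Definition co (x : X) (i : 'I_n) : R := (set_val x : 'rV[R]_n) ord0 i.

Definition mkX (v : 'I_n -> R)
  (vZ : (n - k <= #|[pred i | v i \is a Num.int]|)%N) : X.
Proof.
refine (exist _ (\row_i v i : 'rV[R]_n) (mem_set _)).
apply/ZsetE; apply: leq_trans vZ _; apply: subset_leq_card.
by apply/fintype.subsetP => i; rewrite !inE mxE.
Defined.

Lemma co_mkX v vZ i : co (@mkX v vZ) i = v i.
Proof. by rewrite /co /= set_valE /= mxE. Qed.

Lemma co_card x : (n - k <= #|[pred i | co x i \is a Num.int]|)%N.
Proof. by apply/ZsetE; exact: set_valP. Qed.

Lemma mdistE (x y : X) : mdist x y = Num.sqrt (\sum_(i < n) (co x i - co y i) ^+ 2).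
Proof. by []. Qed.

Lemma co_le x y i : `|co x i - co y i| <= mdist x y.
Proof.
rewrite mdistE -sqrtr_sqr ler_wsqrtr // (bigD1 i) //= lerDl sumr_ge0 // => j _.
exact: sqr_ge0.
Qed.

Lemma mdist_le x y (eta : R) : (forall i, `|co x i - co y i| <= eta) ->
  mdist x y <= n%:R * eta.
Proof.
move=> h; have eta0 : 0 <= eta := le_trans (normr_ge0 _) (h (Ordinal n_gt0)).
rewrite mdistE -[leRHS]ger0_norm ?mulr_ge0 // -sqrtr_sqr ler_wsqrtr //.
apply: (@le_trans _ _ (\sum_(i < n) eta ^+ 2)).
  apply: ler_sum => i _; rewrite -real_normK ?num_real //.
  by rewrite lerXn2r ?nnegrE.
rewrite sumr_const card_ord -(mulr_natl (eta ^+ 2)) exprMn ler_wpM2r ?sqr_ge0 //.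
by rewrite -natrX ler_nat -mulnn leq_pmulr.
Qed.

Lemma origin_subproof : (n - k <= #|[pred i : 'I_n | (0%R : R) \is a Num.int]|)%N.
Proof.
rewrite (@eq_card _ _ 'I_n) ?card_ord ?leq_subr // => i.
by rewrite !inE (natr_int R 0%N).
Qed.

Definition origin : X := mkX origin_subproof.

Lemma co_origin i : co origin i = 0.
Proof. exact: co_mkX. Qed.

Section bounded_complete.
Variables (r : R) (y : T).
Hypothesis ry : closure (e @` [set x | mdist origin x <= r]) y.

(** The [i]-th coordinate truncated to [[-|r|, |r|]]: a member of the ring of
    bounded uniformly continuous functions that agrees with the coordinate on
    the ball of radius [r]. *)
Definition clampco (i : 'I_n) (x : X) : R := Num.max (- `|r|) (Num.min `|r| (co x i)).

Lemma clampco_buc i : buc (clampco i).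
Proof.
apply: (@lipschitz_buc _ _ _ `|r|) => [x|x x'].
  rewrite ler_norml /clampco le_max lexx ge_max ge_min lexx /= andbT.
  by have := normr_ge0 r; lra.
apply: le_trans (co_le x x' i).
exact: le_trans (max_lip _ _ _) (min_lip _ _ _).
Qed.

Definition clampbuc i : buc := exist _ (clampco i) (mem_set (clampco_buc i)).

(** The [i]-th coordinate of the point of the skeleton that [y] will turn out
    to be. *)
Definition limco i : R := coord (clampbuc i) y.

Lemma coord_clamp i x : mdist origin x <= r -> coord (clampbuc i) (e x) = co x i.
Proof.
move=> xr; rewrite coord_eval /= /clampco.
have : `|co x i| <= `|r|.
  have := co_le x origin i; rewrite co_origin subr0 metric_sym => h.
  by apply: le_trans (ler_norm r); apply: le_trans xr.
rewrite ler_norml => /andP[h1 h2].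
by rewrite set_valE /= /clampco min_r // max_r.
Qed.

(** The skeleton is closed: a point of it near the limit has no more integer
    coordinates than the limit has. *)
Lemma limco_card : (n - k <= #|[pred i | limco i \is a Num.int]|)%N.
Proof.
have nb : \forall t \near y, forall i, limco i \isn't a Num.int ->
    coord (clampbuc i) t \isn't a Num.int.
  apply: (@filter_forall T 'I_n (fun i t => limco i \isn't a Num.int ->
    coord (clampbuc i) t \isn't a Num.int) (nbhs y)) => i.
  have [ai|nai] := boolP (limco i \is a Num.int).
    by apply: filterS filterT => t _.
  have /andP[fl fu] := floor_itv (limco i).
  have fl' : (Num.floor (limco i))%:~R < limco i.
    by rewrite lt_def fl andbT; apply: contraNneq nai => ->; exact: intr_int.
  have : \forall t \near y, (Num.floor (limco i))%:~R < coord (clampbuc i) t <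
      (Num.floor (limco i) + 1)%:~R.
    have cc := @coord_continuous R X (clampbuc i) y.
    have : limco i \in `](Num.floor (limco i))%:~R, (Num.floor (limco i) + 1)%:~R[.
      by rewrite in_itv /= fl'.
    move=> /near_in_itvoo /cc; apply: (@filterS _ (nbhs y)) => t.
    by rewrite /= in_itv.
  apply: (@filterS _ (nbhs y)) => t /andP[t1 t2] _; apply/negP => /intrP[c cE].
  by move: t1 t2; rewrite cE !ltr_int; lia.
have [_ [[x xr <-] xi]] := ry nb.
apply: leq_trans (co_card x) _; apply: subset_leq_card.
apply/fintype.subsetP => i; rewrite !inE => xint; apply: contraT => /xi.
by rewrite coord_clamp // xint.
Qed.

(** A point of the compactification adherent to a ball of [X] belongs to [X]. *)
Lemma bounded_complete : range e y.
Proof.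
pose x' := mkX limco_card; exists x' => //.
apply: coord_inj => f; apply/eqP; rewrite -subr_eq0 -normr_le0.
apply/ler_addgt0Pl => eps eps0; rewrite addr0.
have [d d0 dP] := bucP f (divr_gt0 eps0 (ltr0n _ 2)).
have nb : \forall t \near y, forall i,
    `|coord (clampbuc i) y - coord (clampbuc i) t| < d / n.+1%:R.
  apply: (@filter_forall T 'I_n (fun i t =>
    `|coord (clampbuc i) y - coord (clampbuc i) t| < d / n.+1%:R) (nbhs y)) => i.
    have d0' : 0 < d / n.+1%:R by rewrite divr_gt0.
    by have /cvgrPdist_lt /(_ _ d0') := @coord_continuous R X (clampbuc i) y.
have nb' : \forall t \near y, `|coord f y - coord f t| < eps / 2.
  have e0 : 0 < eps / 2 by rewrite divr_gt0.
  by have /cvgrPdist_lt /(_ _ e0) := @coord_continuous R X f y.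
have [_ [[x xr <-] [/= x1 x2]]] := ry (filterI nb nb').
have xx' : mdist x' x < d.
  have h := @mdist_le x' x (d / n.+1%:R).
  apply: (@le_lt_trans _ _ (n%:R * (d / n.+1%:R))).
    by apply: h => i; rewrite co_mkX; apply: ltW; have := x1 i; rewrite coord_clamp.
  by rewrite mulrA ltr_pdivrMr ?ltr0n // mulrC ltr_pM2l // ltr_nat.
have := dP _ _ xx'; rewrite -!coord_eval => h.
have := ler_distD (coord f (e x)) (coord f (e x')) (coord f y).
rewrite (distrC (coord f (e x)) (coord f y)).
by move: x2 h; lra.
Qed.
End bounded_complete.

End Skeleton.

(** * The upper bound *)

Section Upper.
Variables (R : realType) (n k : nat).
Hypothesis n_gt0 : (0 < n)%N.
Local Notation X := (set_type (Zset R n k)).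
Local Notation T := (@smirnov_cube R X).
Local Notation e := (@smirnov_eval R X).

(** Points of [Z_k^n] lying in the [(m-1)]-dimensional skeleton of the cubical
    subdivision of mesh [1/N] of the space; empty for [m = 0]. *)
Definition skel (N m : nat) : set X :=
  [set x | (n < #|[pred i | (N%:R * co x i)%R \is a Num.int]| + m)%N].

Lemma skel0 N : skel N 0 = set0.
Proof.
rewrite -subset0 => x; rewrite /skel /= addn0 ltnNge => /negP; apply.
by rewrite -[leqRHS]card_ord; exact: max_card.
Qed.

Lemma skelT : skel 1 k.+1 = setT.
Proof.
apply/seteqP; split=> // x _; rewrite /skel /= addnS ltnS addnC -leq_subLR.
apply: leq_trans (co_card x) _; apply: subset_leq_card.
by apply/fintype.subsetP => i; rewrite !inE mul1r.
Qed.

(** Index of the half-open cube containing [x] in the subdivision of mesh [1/M]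
    whose walls are shifted by [1/(2M)]. For [M] a multiple of [N], these walls
    never contain a wall of the subdivision of mesh [1/N]. *)
Definition cell (M : nat) (x : X) (i : 'I_n) : int := Num.floor (M%:R * co x i + 2^-1).

(** Two nearby points in different cells have a wall [x_i = g] between them.
    The coordinate [x_i] of [p] is not on the grid of mesh [1/N], so moving [p]
    to the wall keeps the grid coordinates that [p] had and adds one: the
    dimension drops. *)
Lemma skel_step (N t m : nat) (p q : X) : (0 < N)%N -> (0 < t)%N ->
  skel N m.+1 p -> cell (N * t) p <> cell (N * t) q ->
  (forall i, `|co p i - co q i| < (2 * (N * t))%:R^-1) ->
  exists2 s : X, skel (2 * (N * t)) m s &
   forall i, `|co p i - co s i| <= mdist p q.
Proof.
move=> N0 t0 pN cpq pq; set M := (N * t)%N.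
have M0 : (0 : R) < M%:R by rewrite ltr0n muln_gt0 N0.
have [i ci] : exists i, cell M p i != cell M q i.
  apply: contrapT => ni; apply: cpq; apply: funext => i; apply/eqP.
  by apply/negPn; apply/negP => h; apply: ni; exists i.
have [c hc] := floor_neq_between ci.
pose g : R := (c%:~R - 2^-1) / M%:R.
have pg : `|co p i - g| <= `|co p i - co q i|.
  have e1 : M%:R * co p i + 2^-1 - c%:~R = M%:R * (co p i - g).
    by rewrite /g; field; rewrite gt_eqF.
  have e2 : M%:R * co p i + 2^-1 - (M%:R * co q i + 2^-1) =
      M%:R * (co p i - co q i) by ring.
  by move: hc; rewrite e1 e2 !normrM (gtr0_norm M0) ler_pM2l.
have M2g : (2 * M)%:R * g = (2 * c - 1)%:~R.
  rewrite /g natrM rmorphB rmorphM /=; field.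
  by rewrite !pnatr_eq0 -!lt0n N0 t0.
have Npi : N%:R * co p i \isn't a Num.int.
  apply/negP => /intrP[z zE].
  have h : `|(2 * M)%:R * co p i - (2 * M)%:R * g| < 1.
    rewrite -mulrBr normrM gtr0_norm ?ltr0n ?muln_gt0 ?N0 //.
    rewrite -ltr_pdivlMl ?ltr0n ?muln_gt0 ?N0 // mulr1.
    exact: le_lt_trans pg (pq i).
  have E : (2 * M)%:R * co p i = (2 * t%:Z * z)%:~R.
    by rewrite !rmorphM /= -zE /M !natrM; ring.
  (* An even and an odd integer at distance less than 1. *)
  move: h; rewrite M2g E -rmorphB /= -intr_norm ltrz1.
  by lia.
pose v j : R := if j == i then g else co p j.
have vZ : (n - k <= #|[pred j | v j \is a Num.int]|)%N.
  apply: leq_trans (co_card p) _; apply: subset_leq_card.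
  apply/fintype.subsetP => j; rewrite !inE /v; case: eqVneq => // -> h.
  by move: Npi; rewrite rpredM ?natr_int.
exists (mkX vZ); last first.
  move=> j; rewrite co_mkX /v; case: eqVneq => [->|_].
    exact: le_trans pg (co_le p q i).
  by rewrite subrr normr0 mdist_ge0.
move: pN; rewrite /skel /= addnS -addSn => /leq_trans; apply; rewrite leq_add2r.
rewrite (cardD1 i [pred j | ((2 * M)%:R * _)%R \is a Num.int]) inE.
rewrite co_mkX /v eqxx M2g intr_int.
rewrite add1n ltnS; apply: subset_leq_card.
apply/fintype.subsetP => j; rewrite !inE co_mkX /v => jN.
have ji : j != i by apply: contraNneq Npi => <-.
rewrite ji (negbTE ji) /M (_ : (2 * (N * t))%:R = (2 * t)%:R * N%:R :> R); last first.
  by rewrite -natrM; congr (_%:R); lia.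
by rewrite -mulrA rpredM ?natr_int.
Qed.

(** If [P] lies in a skeleton and no cell meets both [P] and [Q], the closures of
    [P] and [Q] only meet in the closure of a skeleton of smaller dimension. *)
Lemma closure_skel_meet (N t m : nat) (P Q : set X) (y : T) :
  (0 < N)%N -> (0 < t)%N -> P `<=` skel N m.+1 ->
  (forall p q, P p -> Q q -> cell (N * t) p <> cell (N * t) q) ->
  closure (e @` P) y -> closure (e @` Q) y ->
  closure (e @` skel (2 * (N * t)) m) y.
Proof.
move=> N0 t0 Psk PQ Py Qy; apply: contrapT => ny.
have cy : closed [set y].
  apply: accessible_closed_set1; apply: hausdorff_accessible.
  exact: smirnov_cube_hausdorff.
have [G1 [G2 [oG1 oG2 yG1 G2s G12]]] : exists U V : set T, [/\ open U, open V,
    [set y] `<=` U, closure (e @` skel (2 * (N * t)) m) `<=` V &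
    closure U `&` closure V = set0].
  apply: smirnov_cube_normal => //; first exact: closed_closure.
  by rewrite -subset0 => _ [-> ].
have [d d0 dP] := smirnov_proximity G12.
have G1y : nbhs y G1 by apply: open_nbhs_nbhs; split=> //; exact: yG1.
have localize (S : set X) : closure (e @` S) y ->
    closure (e @` (S `&` [set x | G1 (e x)])) y.
  move=> Sy W nW; have [_ [[x Sx <-] [Wx Ox]]] := Sy _ (filterI nW G1y).
  by exists (e x); split=> //; exists x.
pose eta : R := Num.min (d / n.+1%:R) (2 * (N * t))%:R^-1.
have eta0 : 0 < eta.
  by rewrite lt_min divr_gt0 //= invr_gt0 ltr0n !muln_gt0 N0.
have [p [q [Pp Qq Op pq]]] : exists p q, [/\ P p, Q q, G1 (e p) & mdist p q < eta].
  apply: contrapT => npq.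
  have := smirnov_separated (A := P `&` [set x | G1 (e x)])
     (B := Q `&` [set x | G1 (e x)]) eta0.
  move=> h; suff : (closure (e @` (P `&` [set x | G1 (e x)])) `&`
     closure (e @` (Q `&` [set x | G1 (e x)]))) y.
    rewrite h // => p q [Pp Op] [Qq _]; rewrite leNgt; apply/negP => pq.
    by apply: npq; exists p, q.
  by split; exact: localize.
move: pq; rewrite lt_min => /andP[pq1 pq2].
have [s sk ps] := skel_step N0 t0 (Psk _ Pp) (PQ _ _ Pp Qq)
  (fun i => le_lt_trans (co_le p q i) pq2).
have es : G2 (e s) by apply: G2s; apply: subset_closure; exists s.
have := dP _ _ Op es; rewrite leNgt => /negP; apply.
apply: le_lt_trans (mdist_le n_gt0 ps) _.
have : n%:R * mdist p q <= n%:R * (d / n.+1%:R) by rewrite ler_wpM2l // ltW.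
move/le_lt_trans; apply.
by rewrite mulrA ltr_pdivrMr ?ltr0n // mulrC ltr_pM2l // ltr_nat.
Qed.

(** Upper bound, by induction on the dimension: the subdivision is chosen so
    fine that no cell meets neighbourhoods of both [A] and [B], and the partition
    is the common boundary of the union of the cells that meet the neighbourhood
    of [A] and of the union of the others. *)
Lemma Ind_lt_skel (m N : nat) (Z : topologicalType) (f : Z -> T) : (0 < N)%N ->
  closed_embedding f -> (forall z, closure (e @` skel N m) (f z)) -> Ind_lt Z m.
Proof.
elim: m N Z f => [|m IH] N Z f N0 fE fsk.
  rewrite /= -subset0 => z _; have := fsk z.
  by rewrite skel0 image_set0 closure0.
move=> A B cA cB AB0; have [fi fc fcl] := fE.
have [GA [GB [oOA oOB AOA BOB OAB]]] : exists U V : set T, [/\ open U, open V,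
    f @` A `<=` U, f @` B `<=` V & closure U `&` closure V = set0].
  apply: (@smirnov_cube_normal R X _ _ (fcl _ cA) (fcl _ cB)).
  rewrite -subset0 => _ [[a Aa <-] [b Bb /fi ba]].
  have : (A `&` B) a by split=> //; rewrite -ba.
  by rewrite AB0.
have [d d0 dP] := smirnov_proximity OAB.
pose t := (Num.bound (n%:R / d)).+1.
have td : n%:R / d < t%:R.
  apply: lt_trans (archi_boundP _) _; first by rewrite divr_ge0 // ltW.
  by rewrite ltr_nat.
pose WA : set X := [set x | exists2 a, GA (e a) & cell (N * t) a = cell (N * t) x].
pose P := skel N m.+1 `&` WA; pose Q := skel N m.+1 `&` ~` WA.
have WA_OB x : WA x -> ~ GB (e x).
  move=> [a Ga ax] Ox; have := dP _ _ Ga Ox; rewrite leNgt => /negP; apply.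
  apply: le_lt_trans (@mdist_le _ _ _ n_gt0 a x (N * t)%:R^-1 _) _ => [i|].
    have M0 : (0 : R) < (N * t)%:R by rewrite ltr0n muln_gt0 N0.
    have := congr1 (fun c : 'I_n -> int => c i) ax.
    rewrite /cell; set u := _ + _; set w := _ + 2^-1 => uw.
    have := floor_itv u; have := floor_itv w; rewrite -uw rmorphD /=.
    move=> /andP[h1 h2] /andP[h3 h4].
    rewrite -[leRHS]mul1r ler_pdivlMr // -[X in _ * X]gtr0_norm // -normrM.
    rewrite (_ : _ * _ = u - w); last by rewrite /u /w; ring.
    by rewrite ler_norml; apply/andP; split; lra.
  rewrite ltr_pdivrMr ?ltr0n ?muln_gt0 ?N0 // -ltr_pdivrMl // mulrC.
  by apply: lt_le_trans td _; rewrite ler_nat leq_pmull.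
have cover z : closure (e @` P) (f z) \/ closure (e @` Q) (f z).
  have := fsk z; rewrite (_ : e @` skel N m.+1 = e @` P `|` e @` Q) ?closureU //.
  rewrite -image_setU -setIUr setUv setIT //.
have cpre S : closed (f @^-1` closure (e @` S)).
  by apply: (continuous_closedP f).1 => //; exact: closed_closure.
pose L := f @^-1` closure (e @` P) `&` f @^-1` closure (e @` Q).
have cL : closed L by exact: closedI.
exists L; split; last first.
  apply: (IH (2 * (N * t))%N _ (f \o set_val)).
  - by rewrite !muln_gt0 N0.
  - exact: closed_embedding_restr.
  - move=> z; have [Pz Qz] := set_valP z.
    apply: (@closure_skel_meet N t m P Q) => // [x [] //|p q [_ pWA] [_ qWA] pq].
    by apply: qWA; have [a Ga ap] := pWA; exists a => //; rewrite ap.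
split=> //; exists (~` (f @^-1` closure (e @` Q))), (~` (f @^-1` closure (e @` P))).
split.
- by apply: closed_openC.
- by apply: closed_openC.
- move=> a Aa /= /(_ GA) [|_ [[x [_ nWA] <-] Ox]].
    by apply: open_nbhs_nbhs; split=> //; apply: AOA; exists a.
  by apply: nWA; exists x.
- move=> b Bb /= /(_ GB) [|_ [[x [_ xWA] <-] Ox]].
    by apply: open_nbhs_nbhs; split=> //; apply: BOB; exists b.
  exact: (WA_OB x).
- split; first by rewrite -subset0 => z [h1 h2]; case: (cover z).
  by rewrite -setCI setIC.
Qed.

Lemma Ind_lt_smirnov_remainder : Ind_lt (set_type (smirnov_remainder X)) k.+1.
Proof.
apply: (@Ind_lt_skel k.+1 1 _ set_val) => //.
  apply: closed_embedding_set_val; apply: closed_smirnov_remainder (@origin R n k) _.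
  exact: bounded_complete.
by move=> z; rewrite skelT; have [] := set_valP z.
Qed.

End Upper.

(** * The lower bound *)

Section Lower.
Variables (R : realType) (n k : nat).
Hypothesis n_gt0 : (0 < n)%N.
Hypothesis k_le_n : (k <= n)%N.
Local Notation X := (set_type (Zset R n k)).
Local Notation T := (@smirnov_cube R X).
Local Notation e := (@smirnov_eval R X).

(** Points whose [i]-th coordinate is an even integer.  With [odd_face i], the
    union of all [i]-th faces of the cubes; two opposite faces of a cube are one
    in each set.  Both sets are empty for [i >= n]. *)
Definition even_face (i : nat) : set X :=
  [set x | exists (j : 'I_n) (c : int), j = i :> nat /\ co x j = (2 * c)%:~R].

(** Points whose [i]-th coordinate is an odd integer. *)
Definition odd_face (i : nat) : set X :=
  [set x | exists (j : 'I_n) (c : int), j = i :> nat /\ co x j = (2 * c + 1)%:~R].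

Lemma faces_separated i :
  closure (e @` even_face i) `&` closure (e @` odd_face i) = set0.
Proof.
apply: (@smirnov_separated _ _ _ _ 1) => // x y [j [c [ji xj]]] [j' [c' [ji' yj]]].
have jj' : j' = j by apply: val_inj; rewrite /= ji ji'.
rewrite jj' in yj; apply: le_trans (co_le x y j).
rewrite xj yj -rmorphB /= -intr_norm -[1]/(1%:~R) ler_int.
by lia.
Qed.

Section Grid.
Variables (r N : nat).
Local Notation grid := {ffun 'I_k -> 'I_N.+2}.

(** The regular grid of mesh [1/(N+1)] on the [k]-dimensional face
    [[2r, 2r+1] x [0,1]^(k-1) x {0}^(n-k)] of [Z_k^n] (for [k = 0], on the point
    [(2r, 0, ..., 0)]). *)
Definition grid_co (z : grid) (j : 'I_n) : R :=
  (if j == 0%N :> nat then (2 * r)%:R else 0) +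
  (if insub (j : nat) is Some i then (z i)%:R / N.+1%:R else 0).

Lemma grid_co_lt z (i : 'I_k) (j : 'I_n) : j = i :> nat ->
  grid_co z j = (if j == 0%N :> nat then (2 * r)%:R else 0) + (z i)%:R / N.+1%:R.
Proof. by move=> ji; rewrite /grid_co ji valK. Qed.

(** The last [n - k] coordinates are integers. *)
Lemma grid_co_int z :
  (n - k <= #|[pred j | grid_co z j \is a Num.int]|)%N.
Proof.
pose h (a : 'I_(n - k)) : 'I_n := cast_ord (subnKC k_le_n) (rshift k a).
have hi : injective h by move=> a b /cast_ord_inj /rshift_inj.
rewrite -[leqLHS]card_ord -(card_codom hi).
apply: subset_leq_card; apply/fintype.subsetP => _ /codomP[a ->].
rewrite inE /grid_co insubN /= ?addr0 ?ltnNge ?leq_addr //.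
by case: ifP => _; [exact: natr_int|exact: (natr_int R 0%N)].
Qed.

Definition grid_pt (z : grid) : X := mkX (grid_co_int z).

Lemma co_grid_pt z j : co (grid_pt z) j = grid_co z j.
Proof. exact: co_mkX. Qed.

Lemma grid_pt_even (z : grid) (i : 'I_k) : z i = 0 -> even_face i (grid_pt z).
Proof.
move=> zi; pose j := widen_ord k_le_n i.
exists j, (if i == 0%N :> nat then r%:Z else 0); split=> //.
rewrite co_grid_pt (@grid_co_lt z i) // zi mul0r addr0 /=.
case: ifP => _; last by rewrite mulr0.
by rewrite natrM rmorphM.
Qed.

Lemma grid_pt_odd (z : grid) (i : 'I_k) : z i = ord_max -> odd_face i (grid_pt z).
Proof.
move=> zi; pose j := widen_ord k_le_n i.
exists j, (if i == 0%N :> nat then r%:Z else 0); split=> //.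
rewrite co_grid_pt (@grid_co_lt z i) // zi divff ?pnatr_eq0 // intrD.
congr (_ + _); rewrite [nat_of_ord j]/=; case: ifP => _; last by rewrite mulr0.
by rewrite natrM rmorphM.
Qed.

Lemma grid_pt_far z : (2 * r)%:R <= mdist (origin R n k) (grid_pt z).
Proof.
have := co_le (grid_pt z) (origin R n k) (Ordinal n_gt0).
rewrite co_origin subr0 metric_sym; apply: le_trans.
rewrite co_grid_pt /grid_co eqxx; apply: le_trans (ler_norm _).
by rewrite lerDl; case: insubP => // i _ _; rewrite divr_ge0.
Qed.

(** At most one step apart in each coordinate. *)
Definition adjacent (z w : grid) : Prop :=
  forall l, (z l <= (w l).+1)%N /\ (w l <= (z l).+1)%N.

Lemma adjacent_refl z : adjacent z z.
Proof. by move=> l; split. Qed.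

Lemma adjacent_corner (z : grid) (S : {set 'I_k}) : (forall l, z l != ord_max) ->
  adjacent (z + corner N S) z.
Proof.
move=> zN l.
have zl : (z l < N.+1)%N.
  have := zN l; rewrite -val_eqE /= => zl.
  by have := ltn_ord (z l); rewrite ltnS leq_eqVlt (negbTE zl).
rewrite cornerE /=; case: (l \in S) => /=.
  by rewrite (@modn_small 1) // modn_small addn1 //; split=> //; rewrite ltnW.
by rewrite modn_small addn0 ?(ltn_ord (z l)) //; split.
Qed.

Lemma mdist_adjacent z w : adjacent z w ->
  mdist (grid_pt z) (grid_pt w) <= n%:R / N.+1%:R.
Proof.
move=> zw; apply: mdist_le => // j.
rewrite !co_grid_pt /grid_co opprD addrACA subrr add0r.
case: insubP => [i _ _|_]; last by rewrite subr0 normr0 invr_ge0.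
rewrite -mulrBl normrM [X in _ * X]ger0_norm ?invr_ge0 // ler_piMl ?invr_ge0 //.
have [h1 h2] := zw i.
move: h1 h2; rewrite -!(ler_nat R) -!natr1 => h1 h2.
by rewrite ler_norml; apply/andP; split; lra.
Qed.

End Grid.

(** Lower bound.  Otherwise the [k] pairs of opposite faces would be separated
    by pairs [(U_i, V_i)] covering the remainder, hence covering a unit cube far
    away.  On a grid much finer than the distances between the traces of [U_i]
    and [V_i], this contradicts [discrete_miranda]. *)
Lemma not_Ind_lt_smirnov_remainder : ~ Ind_lt (set_type (smirnov_remainder X)) k.
Proof.
move=> Yk.
have bc := @bounded_complete R n k n_gt0.
have cA i : closed (closure (e @` even_face i)) by exact: closed_closure.
have cB i : closed (closure (e @` odd_face i)) by exact: closed_closure.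
have [U [V [UVP UVc]]] := Ind_lt_cover (@smirnov_cube_normal R X)
  (closed_embedding_set_val (closed_smirnov_remainder bc)) Yk cA cB
  (fun i _ => faces_separated i).
pose O := \bigcup_(i in [set i | (i < k)%N]) (U i `|` V i).
have oO : open O by apply: bigcup_open => i /UVP[? ? _ _ _]; exact: openU.
have YO : smirnov_remainder X `<=` O.
  by move=> y Yy; have [i ik UVy] := UVc (exist _ y (mem_set Yy)); exists i.
have [r0 r0P] := smirnov_remainder_nbhs bc oO YO.
pose r := Num.bound `|r0|.
have sep (i : 'I_k) : exists N : nat, forall x y, U i (e x) -> V i (e y) ->
    (2 * n)%:R / N.+1%:R < mdist x y.
  have [_ _ _ _ /smirnov_proximity[d d0 dP]] := UVP i (ltn_ord i).
  exists (Num.bound ((2 * n)%:R / d)) => x y Ux Vy.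
  apply: lt_le_trans (dP _ _ Ux Vy).
  rewrite ltr_pdivrMr // -ltr_pdivrMl // mulrC.
  apply: lt_trans (archi_boundP _) _; first by rewrite divr_ge0 // ltW.
  by rewrite ltr_nat.
have [Ni NiP] := choice sep.
pose N := (\max_(i < k) Ni i)%N.
have sepN (i : 'I_k) x y : U i (e x) -> V i (e y) -> (2 * n)%:R / N.+1%:R < mdist x y.
  move=> Ux Vy; apply: le_lt_trans (NiP i x y Ux Vy).
  by rewrite ler_wpM2l // lef_pV2 ?posrE // ler_nat ltnS; exact: leq_bigmax.
pose pt := @grid_pt r N.
(* [u i] is false near [U i] and true elsewhere.  It is constant on each unit
   cube with a vertex in [U i] or in [V i]. *)
pose near_U (i : 'I_k) z := exists2 w, adjacent z w & U i (e (pt w)).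
pose u (i : 'I_k) (z : {ffun 'I_k -> 'I_N.+2}) : bool := ~~ `[< near_U i z >].
have n2 : n%:R / N.+1%:R + n%:R / N.+1%:R = (2 * n)%:R / N.+1%:R :> R.
  by rewrite -mulrDl natrM mulr_natl mulr2n.
have n1 : n%:R / N.+1%:R <= (2 * n)%:R / N.+1%:R :> R.
  by rewrite -n2 lerDl divr_ge0.
have u0 i (z : {ffun 'I_k -> 'I_N.+2}) : z i = 0 -> u i z = false.
  move=> zi; apply/negbTE; rewrite negbK; apply/asboolP.
  exists z; first exact: adjacent_refl.
  have [_ _ AU _ _] := UVP i (ltn_ord i); apply: AU; apply: subset_closure.
  by exists (pt z) => //; exact: grid_pt_even.
have u1 i (z : {ffun 'I_k -> 'I_N.+2}) : z i = ord_max -> u i z = true.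
  move=> zi; apply/negP => /asboolP[w zw Uw].
  have Vz : V i (e (pt z)).
    have [_ _ _ BV _] := UVP i (ltn_ord i); apply: BV; apply: subset_closure.
    by exists (pt z) => //; exact: grid_pt_odd.
  have := sepN i _ _ Uw Vz; rewrite ltNge metric_sym => /negP; apply.
  exact: le_trans (mdist_adjacent _ zw) n1.
have [z zN zP] := discrete_miranda u0 u1.
have [i ik UVi] : O (e (pt z)).
  apply: r0P; apply: lt_le_trans (grid_pt_far _ z).
  apply: le_lt_trans (ler_norm _) _.
  apply: lt_le_trans (archi_boundP (normr_ge0 _)) _.
  by rewrite ler_nat leq_pmull.
have [S1 [S2 [uS1 uS2]]] := zP (Ordinal ik).
case: UVi => [Uz|Vz].
  move/negP: uS2; apply; apply/asboolP; exists z => //; exact: adjacent_corner.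
move/negbT: uS1; rewrite negbK => /asboolP[w zw Uw].
have := sepN (Ordinal ik) _ _ Uw Vz; rewrite ltNge => /negP; apply.
rewrite -n2; apply: le_trans (metric_triangle _ (pt (z + corner N S1)) _) _.
apply: lerD; last by apply: mdist_adjacent; exact: adjacent_corner.
by rewrite metric_sym; exact: mdist_adjacent.
Qed.

End Lower.

Theorem theorem2p3 (R : realType) (n k : nat) (n_gt0 : (0 < n)%N)
    (k_le_n : (k <= n)%N) :
  Ind_eq (set_type (smirnov_remainder (set_type (Zset R n k)))) k.
Proof.
split; first exact: Ind_lt_smirnov_remainder.
exact: not_Ind_lt_smirnov_remainder.
Qed.
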